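(* For every positive integer $m$ there exists a constant $c(m)$ such that if $l>c(m)$ and $d\le l$, then $M(l,m,8)_d>1.18^{\,l}$. That is, there is a set of more than $1.18^l$ presentations of the trivial group, each with $8$ generators and of length at most $l$, such that $T_d(\mu,\mu')>\exp_m(l)$ for every two distinct presentations $\mu,\mu'$ in the set.
   Context: $\exp_0(x)=x$, $\exp_{m+1}(x)=2^{\exp_m(x)}$. The length of a presentation is the sum of its relator lengths plus the number of generators. $T_d(\mu,\mu')$ is the minimal number of elementary Tietze transformations needed to pass from $\mu$ to $\mu'$, where the elementary transformations of $\langle x_1,\dots,x_r\mid a_1,\dots,a_p\rangle$ are: inserting ($Op_1$) or deleting ($Op_1^{-1}$) a subword $x_j^{\epsilon}x_j^{-\epsilon}$ ($\epsilon=\pm1$) in a relator; cyclically permuting a relator ($Op_2$); replacing $a_i$ by $a_i^{-1}$ ($Op_3$); replacing $a_i$ by $a_ia_j$, $j\neq i$ ($Op_4$); adding a generator $x_{r+1}$ with relator $x_{r+1}w$, $w$ a word on $a_1,\dots,a_p$ of length at most $d-1$ ($Op_5(d)$) and its inverse $Op_5^{-1}(d)$; adding or deleting an empty relator ($Op_6^{\pm1}$). A set $S$ of presentations of the trivial group, each of length at most $l$ and with $k$ generators, is $(l,m,k)_d$-disconnected if $T_d(\mu,\mu')>\exp_m(l)$ for all distinct $\mu,\mu'\in S$; $M(l,m,k)_d$ is the maximal size of an $(l,m,k)_d$-disconnected set. *)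

(* Defs.v *)
From mathcomp Require Import all_boot.
Set Implicit Arguments. Unset Strict Implicit. Unset Printing Implicit Defensive.

(* A letter x_j^{eps}: (j, true) is x_j, (j, false) is x_j^{-1}.
   Generators of a presentation with r generators are x_0, ..., x_{r-1}. *)
Definition letter := (nat * bool)%type.
Definition word := seq letter.
(* A presentation <x_0..x_{r-1} | a_0..a_{p-1}>: (r, [:: a_0; ...; a_{p-1}]). *)
Definition pres := (nat * seq word)%type.

Definition inv_letter (x : letter) : letter := (x.1, ~~ x.2).
Definition inv_word (w : word) : word := rev (map inv_letter w).

Definition pres_length (mu : pres) : nat := mu.1 + sumn (map size mu.2).

Definition pres_wf (mu : pres) : bool :=
  all (fun a : word => all (fun x : letter => x.1 < mu.1) a) mu.2.

(* Equality in the group presented: the congruence on words generated by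
   free cancellation and insertion/deletion of relators. *)
Inductive weq (R : seq word) : word -> word -> Prop :=
| weq_refl w : weq R w w
| weq_sym w1 w2 : weq R w1 w2 -> weq R w2 w1
| weq_trans w1 w2 w3 : weq R w1 w2 -> weq R w2 w3 -> weq R w1 w3
| weq_cancel u v x : weq R (u ++ x :: inv_letter x :: v) (u ++ v)
| weq_rel u v a : a \in R -> weq R (u ++ a ++ v) (u ++ v).

Definition presents_trivial (mu : pres) : Prop :=
  forall j, j < mu.1 -> weq mu.2 [:: (j, true)] [::].

Definition relw (R : seq word) (i : nat) : word := nth [::] R i.

Inductive tstep (d : nat) : pres -> pres -> Prop :=
| Op1 r R i u v x : i < size R -> relw R i = u ++ v -> x.1 < r ->
    tstep d (r, R) (r, set_nth [::] R i (u ++ x :: inv_letter x :: v))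
| Op1inv r R i u v x : i < size R -> relw R i = u ++ x :: inv_letter x :: v ->
    tstep d (r, R) (r, set_nth [::] R i (u ++ v))
| Op2 r R i n : i < size R ->
    tstep d (r, R) (r, set_nth [::] R i (rot n (relw R i)))
| Op3 r R i : i < size R ->
    tstep d (r, R) (r, set_nth [::] R i (inv_word (relw R i)))
| Op4 r R i j : i < size R -> j < size R -> i != j ->
    tstep d (r, R) (r, set_nth [::] R i (relw R i ++ relw R j))
(* Op_5(d): new generator x_r (0-based) with relator x_r w, where w is a word
   a_{i_1}^{e_1} ... a_{i_k}^{e_k} on the relators with k <= d - 1 (i.e. k < d). *)
| Op5 r R (ws : seq (nat * bool)) :
    all (fun q => q.1 < size R) ws -> size ws < d ->
    tstep d (r, R)
      (r.+1, rcons R ((r, true) ::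
         flatten [seq (if q.2 then relw R q.1 else inv_word (relw R q.1)) | q <- ws]))
| Op5inv r R (ws : seq (nat * bool)) :
    all (fun q => q.1 < size R) ws -> size ws < d ->
    tstep d
      (r.+1, rcons R ((r, true) ::
         flatten [seq (if q.2 then relw R q.1 else inv_word (relw R q.1)) | q <- ws]))
      (r, R)
| Op6 r R n : n <= size R ->
    tstep d (r, R) (r, take n R ++ [::] :: drop n R)
| Op6inv r R n : n <= size R ->
    tstep d (r, take n R ++ [::] :: drop n R) (r, R).

Inductive tsteps (d : nat) : nat -> pres -> pres -> Prop :=
| tsteps0 mu : tsteps d 0 mu mu
| tstepsS n mu nu rho : tstep d mu nu -> tsteps d n nu rho -> tsteps d n.+1 mu rho.

(* T_d(mu, mu') > N  (including the case that mu' is unreachable) *)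
Definition Td_gt (d : nat) (mu mu' : pres) (N : nat) : Prop :=
  forall n, n <= N -> ~ tsteps d n mu mu'.

Definition expm (m x : nat) : nat := iter m (fun y => 2 ^ y) x.

Definition disconnected (l m k d : nat) (S : seq pres) : Prop :=
  uniq S /\
  (forall mu, mu \in S ->
     [/\ mu.1 = k, pres_wf mu, pres_length mu <= l & presents_trivial mu]) /\
  (forall mu mu', mu \in S -> mu' \in S -> mu != mu' -> Td_gt d mu mu' (expm m l)).

(* Main.v *)
Require Import Defs.
From mathcomp Require Import all_boot all_fingroup all_algebra zify ring.
From Stdlib Require Import Setoid Morphisms.
Set Implicit Arguments. Unset Strict Implicit. Unset Printing Implicit Defensive.
Import GRing.Theory.

(* No elementary Tietze transformation substitutes a generator: generators are only created or
   destroyed by a relator x_r w with w a word in the other relators.  Hence, for a fixed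
   assignment of permutations of a finite set to the generators, if every relator and every
   absent generator moves at most E points, one transformation replaces E by at most (d + 2) E.

   The presentations have generators x, z, t, b, f, g, h, y.  The relations z = t x t^-1 and
   z x z^-1 = x^2 (Baumslag-Gersten) make a word v of length O(2^n) equal to x^N, with N a tower
   of n twos.  As b commutes with x, it commutes with v, and [v b v^-1, f] = 1 makes b and f
   commute; their other relations are those of SL(2,5), which is perfect, so b = f = 1.  Then
   f^5 g f^-5 = g^2 and the same for h give g = h = 1, so t = [h^-1, g] = 1, and x = z = 1.
   A last relation y = W(z, x), with W coding q bits, produces 2^q presentations.

   If the relations are only required to hold outside a proportion 2/N of a finite set, there is
   a far from trivial model: x acts on many levels by long cycles, b and f act on a fibre by left
   or by right multiplications of GL(2,5), alternating along each cycle of x every N steps, and t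
   shifts the levels.  There the words W of two bit sequences differ on at least half of the
   points, so a path of k transformations between two of the presentations needs 4 (d + 2)^k >= N. *)

#[export] Hint Resolve weq_refl : core.

Section WordCongruence.
Variable R : seq word.

Lemma weq_cat2 u v w1 w2 : weq R w1 w2 -> weq R (u ++ w1 ++ v) (u ++ w2 ++ v).
Proof.
elim=> {w1 w2} [w|w1 w2 _|w1 w2 w3 _ IH1 _|u' v' x|u' v' a aR].
- exact: weq_refl.
- exact: weq_sym.
- exact: weq_trans.
- by rewrite -!catA !catA -!catA catA [u ++ u' ++ _]catA; exact: weq_cancel.
- by rewrite -!catA catA [u ++ u' ++ _]catA; exact: weq_rel.
Qed.

#[export] Instance weq_Equivalence : Equivalence (weq R).
Proof. by split; [exact: weq_refl | exact: weq_sym | exact: weq_trans]. Qed.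

#[export] Instance cat_weq_Proper : Proper (weq R ==> weq R ==> weq R) cat.
Proof.
move=> u u' uu' v v' vv'; apply: (weq_trans (w2 := u' ++ v)).
  exact: (weq_cat2 [::] v uu').
by have := weq_cat2 u' [::] vv'; rewrite !cats0.
Qed.

#[export] Instance cons_weq_Proper x : Proper (weq R ==> weq R) (cons x).
Proof. by move=> u v uv; exact: (@cat_weq_Proper [:: x] _ (weq_refl R _) _ _ uv). Qed.

Lemma inv_word_cat u v : inv_word (u ++ v) = inv_word v ++ inv_word u.
Proof. by rewrite /inv_word map_cat rev_cat. Qed.

Lemma inv_letterK : involutive inv_letter.
Proof. by case=> j e; rewrite /inv_letter negbK. Qed.

Lemma inv_wordK : involutive inv_word.
Proof. by move=> w; rewrite /inv_word map_rev revK mapK //; exact: inv_letterK. Qed.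

Lemma weq_mulV w : weq R (w ++ inv_word w) [::].
Proof.
elim: w => [|x w IH]; first exact: weq_refl.
apply: (weq_trans (w2 := [:: x; inv_letter x])); last exact: (weq_cancel R [::] [::] x).
have := weq_cat2 [:: x] [:: inv_letter x] IH.
by rewrite -[x :: w]/([:: x] ++ w) inv_word_cat -!catA.
Qed.

Lemma weq_mulKV w u : weq R (w ++ inv_word w ++ u) u.
Proof. by rewrite catA weq_mulV. Qed.

Lemma weq_mulVK w u : weq R (inv_word w ++ w ++ u) u.
Proof. by have := weq_mulKV (inv_word w) u; rewrite inv_wordK. Qed.

Lemma weq_relator u v : u ++ inv_word v \in R -> weq R u v.
Proof.
move=> uvR; have := weq_rel [::] v uvR; rewrite /= -catA => <-.
by have := weq_mulVK v [::]; rewrite cats0 => ->; rewrite cats0.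
Qed.

Lemma weq_cancel_l w u v : weq R (w ++ u) (w ++ v) -> weq R u v.
Proof. by move=> uv; rewrite -(weq_mulVK w u) uv weq_mulVK. Qed.

#[export] Instance inv_weq_Proper : Proper (weq R ==> weq R) inv_word.
Proof.
move=> u v uv; apply: (weq_cancel_l (w := u)).
by rewrite weq_mulV uv weq_mulV.
Qed.

Lemma weq_sqr_id w : weq R w (w ++ w) -> weq R w [::].
Proof. by move=> ww; symmetry; apply: (weq_cancel_l (w := w)); rewrite cats0. Qed.

End WordCongruence.

Notation Gx := (0, true).
Notation Gz := (1, true).
Notation Gt := (2, true).
Notation Gb := (3, true).
Notation Gf := (4, true).
Notation Gg := (5, true).
Notation Gh := (6, true).
Notation Gy := (7, true).

Definition tower (k : nat) : nat := iter k (fun y => 2 ^ y) 1.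

Fixpoint vword (k : nat) : word :=
  if k is k'.+1 then
    Gt :: vword k' ++ [:: inv_letter Gt; Gx; Gt] ++ inv_word (vword k') ++ [:: inv_letter Gt]
  else [:: Gx].

Fixpoint bitword (s : seq bool) : word :=
  if s is e :: s' then Gz :: (if e then Gx :: bitword s' else bitword s') else [::].

Definition hard_rels (n : nat) : seq word :=
  [:: [:: Gt; Gx] ++ inv_word [:: Gz; Gt];
      [:: Gt] ++ inv_word [:: inv_letter Gh; Gg; Gh; inv_letter Gg];
      [:: Gz; Gx] ++ inv_word [:: Gx; Gx; Gz];
      [:: Gb; Gx] ++ inv_word [:: Gx; Gb];
      (vword n ++ Gb :: inv_word (vword n) ++ [:: Gf])
        ++ inv_word (Gf :: vword n ++ Gb :: inv_word (vword n));
      nseq 3 Gb; nseq 10 Gf;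
      [:: Gb; Gf; Gb] ++ inv_word (nseq 4 Gf);
      (nseq 5 Gf ++ [:: Gg]) ++ inv_word ([:: Gg; Gg] ++ nseq 5 Gf);
      (nseq 5 Gf ++ [:: Gh]) ++ inv_word ([:: Gh; Gh] ++ nseq 5 Gf)].

Definition hard_pres (n : nat) (s : seq bool) : pres :=
  (8, rcons (hard_rels n) ([:: Gy] ++ inv_word (bitword s))).

Section Trivial.
Variables (n : nat) (s : seq bool).
Let R := (hard_pres n s).2.
Local Notation "u =~ v" := (weq R u v) (at level 70).

Local Ltac rel i := apply: weq_relator; rewrite /R mem_rcons inE;
  apply/orP; right; apply: (@mem_nth _ [::] (hard_rels n) i); exact: isT.

Let tx : [:: Gt; Gx] =~ [:: Gz; Gt]. Proof. by rel 0. Qed.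
Let tgh : [:: Gt] =~ [:: inv_letter Gh; Gg; Gh; inv_letter Gg]. Proof. by rel 1. Qed.
Let zx : [:: Gz; Gx] =~ [:: Gx; Gx; Gz]. Proof. by rel 2. Qed.
Let bx : [:: Gb; Gx] =~ [:: Gx; Gb]. Proof. by rel 3. Qed.
Let vbf : vword n ++ Gb :: inv_word (vword n) ++ [:: Gf]
  =~ Gf :: vword n ++ Gb :: inv_word (vword n). Proof. by rel 4. Qed.
Let b3 : nseq 3 Gb =~ [::]. Proof. by rel 5. Qed.
Let f10 : nseq 10 Gf =~ [::]. Proof. by rel 6. Qed.
Let bfb : [:: Gb; Gf; Gb] =~ nseq 4 Gf. Proof. by rel 7. Qed.
Let fg : nseq 5 Gf ++ [:: Gg] =~ [:: Gg; Gg] ++ nseq 5 Gf. Proof. by rel 8. Qed.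
Let fh : nseq 5 Gf ++ [:: Gh] =~ [:: Gh; Gh] ++ nseq 5 Gf. Proof. by rel 9. Qed.
Let yW : [:: Gy] =~ bitword s.
Proof. by apply: weq_relator; rewrite /R mem_rcons mem_head. Qed.

Let tX k : Gt :: nseq k Gx =~ nseq k Gz ++ [:: Gt].
Proof.
elim: k => [|k IH] /=; first exact: weq_refl.
rewrite -[_ :: _ :: _]/([:: Gt; Gx] ++ nseq k Gx) tx.
by rewrite -[_ :: nseq k Gz ++ _]/([:: Gz] ++ (nseq k Gz ++ [:: Gt])) -IH.
Qed.

Let zX j : Gz :: nseq j Gx =~ nseq (j.*2) Gx ++ [:: Gz].
Proof.
elim: j => [|j IH] /=; first exact: weq_refl.
rewrite -[_ :: _ :: _]/([:: Gz; Gx] ++ nseq j Gx) zx.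
by rewrite -[_ :: _ :: nseq _ _ ++ _]/([:: Gx; Gx] ++ (nseq j.*2 Gx ++ [:: Gz])) -IH.
Qed.

Let ZX k : nseq k Gz ++ [:: Gx] =~ nseq (2 ^ k) Gx ++ nseq k Gz.
Proof.
elim: k => [|k IH]; first exact: weq_refl.
rewrite -[nseq k.+1 Gz ++ _]/([:: Gz] ++ (nseq k Gz ++ [:: Gx])) IH.
rewrite catA -[[:: Gz] ++ _]/(Gz :: nseq (2 ^ k) Gx) zX -catA.
by rewrite expnS mul2n.
Qed.

Lemma vword_weq k : vword k =~ nseq (tower k) Gx.
Proof.
elim: k => [|k IH]; first exact: weq_refl.
have tv : [:: Gt] ++ vword k ++ [:: inv_letter Gt] =~ nseq (tower k) Gz.
  rewrite IH catA [[:: Gt] ++ _]tX -catA.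
  by rewrite -[[:: inv_letter Gt]]/(inv_word [:: Gt]) weq_mulV cats0.
transitivity (([:: Gt] ++ vword k ++ [:: inv_letter Gt]) ++ [:: Gx] ++
   inv_word ([:: Gt] ++ vword k ++ [:: inv_letter Gt])).
  by rewrite !inv_word_cat /= -!catA.
rewrite tv catA ZX -catA weq_mulV cats0; reflexivity.
Qed.

Lemma weq_b_x k : Gb :: nseq k Gx =~ nseq k Gx ++ [:: Gb].
Proof.
elim: k => [|k IH] /=; first exact: weq_refl.
rewrite -[_ :: _ :: _]/([:: Gb; Gx] ++ nseq k Gx) bx.
by rewrite -[_ :: nseq k Gx ++ _]/([:: Gx] ++ (nseq k Gx ++ [:: Gb])) -IH.
Qed.

Let vb : vword n ++ Gb :: inv_word (vword n) =~ [:: Gb].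
Proof.
have E : vword n ++ [:: Gb] =~ [:: Gb] ++ vword n.
  by rewrite vword_weq -weq_b_x.
by rewrite -[Gb :: _]/([:: Gb] ++ inv_word (vword n)) catA E -catA weq_mulV.
Qed.

Let bf : [:: Gb; Gf] =~ [:: Gf; Gb].
Proof.
have := vbf.
rewrite -[Gb :: _ ++ [:: Gf]]/((Gb :: inv_word (vword n)) ++ [:: Gf]).
by rewrite catA vb.
Qed.

Let bb : [:: Gb; Gb] =~ nseq 3 Gf.
Proof.
apply: (weq_cancel_l (w := [:: Gf])).
rewrite -[[:: Gf] ++ nseq 3 Gf]/(nseq 4 Gf) -bfb.
exact: (cat_weq_Proper (weq_sym bf) (weq_refl R [:: Gb])).
Qed.

Let f0 : [:: Gf] =~ [::].
Proof.
have b4 : nseq 4 Gb =~ [:: Gb].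
  by rewrite -[nseq 4 Gb]/(nseq 3 Gb ++ [:: Gb]) b3.
have b6 : [:: Gb] =~ nseq 6 Gf.
  by rewrite -b4 -[nseq 4 Gb]/([:: Gb; Gb] ++ [:: Gb; Gb]) bb.
have f18 : nseq 18 Gf =~ [::].
  by rewrite -[nseq 18 Gf]/(nseq 6 Gf ++ nseq 6 Gf ++ nseq 6 Gf) -b6.
have f8 : nseq 8 Gf =~ [::] by rewrite -f18 -[nseq 18 Gf]/(nseq 10 Gf ++ nseq 8 Gf) f10.
have f9 : nseq 9 Gf =~ [::].
  apply: (weq_cancel_l (w := nseq 3 Gf)); rewrite cats0.
  have f12 : nseq 6 Gf ++ nseq 6 Gf =~ nseq 3 Gf by rewrite -b6; exact: bb.
  exact: f12.
by have := f9; rewrite -[nseq 9 Gf]/(nseq 8 Gf ++ [:: Gf]) f8.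
Qed.

Let b0 : [:: Gb] =~ [::].
Proof.
have bb0 : [:: Gb; Gb] =~ [::].
  by rewrite bb -[nseq 3 Gf]/([:: Gf] ++ [:: Gf] ++ [:: Gf]) !f0.
by have := b3; rewrite -[nseq 3 Gb]/([:: Gb; Gb] ++ [:: Gb]) bb0.
Qed.

Let f5 : nseq 5 Gf =~ [::].
Proof. by rewrite -[nseq 5 Gf]/([:: Gf] ++ [:: Gf] ++ [:: Gf] ++ [:: Gf] ++ [:: Gf]) !f0. Qed.

Let g0 : [:: Gg] =~ [::].
Proof. by apply: weq_sqr_id; have := fg; rewrite f5 cats0. Qed.

Let h0 : [:: Gh] =~ [::].
Proof. by apply: weq_sqr_id; have := fh; rewrite f5 cats0. Qed.

Let t0 : [:: Gt] =~ [::].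
Proof.
rewrite tgh -[[:: inv_letter Gh; _; _; _]]/(inv_word [:: Gh] ++ [:: Gg] ++ [:: Gh] ++ inv_word [:: Gg]).
by rewrite g0 h0.
Qed.

Let zx0 : [:: Gz] =~ [:: Gx].
Proof.
have := tx; rewrite -[[:: Gt; Gx]]/([:: Gt] ++ [:: Gx]) -[[:: Gz; Gt]]/([:: Gz] ++ [:: Gt]) t0.
by rewrite cats0 => <-.
Qed.

Let x0 : [:: Gx] =~ [::].
Proof.
symmetry; apply: (weq_cancel_l (w := [:: Gx; Gx])); rewrite cats0.
have := zx; rewrite -[[:: Gz; Gx]]/([:: Gz] ++ [:: Gx]).
by rewrite -[[:: Gx; Gx; Gz]]/([:: Gx; Gx] ++ [:: Gz]) zx0.
Qed.

Lemma hard_pres_trivial : presents_trivial (hard_pres n s).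
Proof.
have z0 : [:: Gz] =~ [::] by rewrite zx0 x0.
have W0 : forall s', bitword s' =~ [::].
  elim=> [|e s' IH] /=; first exact: weq_refl.
  rewrite -[Gz :: _]/([:: Gz] ++ _) z0; case: e => //=.
  by rewrite -[Gx :: _]/([:: Gx] ++ _) x0.
have y0 : [:: Gy] =~ [::] by rewrite yW W0.
by case=> [|[|[|[|[|[|[|[|j]]]]]]]] // _.
Qed.

End Trivial.

Section Displacement.
Variable T : finType.
Implicit Types s t : {perm T}.
Local Open Scope group_scope.

Definition displ s : nat := #|[set w | s w != w]|.

Lemma displ1 : displ 1 = 0.
Proof. by apply/eqP; rewrite cards_eq0; apply/eqP/setP=> w; rewrite !inE perm1 eqxx. Qed.

Lemma displM s t : displ (s * t) <= displ s + displ t.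
Proof.
rewrite /displ -cardsUI (leq_trans _ (leq_addr _ _)) // subset_leq_card //.
apply/subsetP=> w; rewrite !inE permM -negb_and; apply: contra => /andP[/eqP-> /eqP->]; exact/eqP.
Qed.

Lemma displJ s t : displ (s ^ t) = displ s.
Proof.
rewrite /displ -(card_imset [set w | s w != w] (@perm_inj _ t)); congr #|pred_of_set _|.
apply/setP=> w; apply/idP/imsetP => [|[w' + ->]]; rewrite inE; last first.
  by rewrite inE permJ (inj_eq perm_inj).
move=> sw; exists (t^-1 w); last by rewrite permKV.
by rewrite inE; move: sw; rewrite -{1 2}[w](permKV t) permJ (inj_eq perm_inj).
Qed.

Lemma displV s : displ s^-1 = displ s.
Proof.
rewrite /displ; congr #|pred_of_set _|; apply/setP=> w; rewrite !inE.
by rewrite -(inj_eq (@perm_inj _ s)) permKV eq_sym.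
Qed.

Variable rho : nat -> {perm T}.

Definition evl (x : letter) : {perm T} := if x.2 then rho x.1 else (rho x.1)^-1.

Definition ev (w : word) : {perm T} := \prod_(x <- w) evl x.

Lemma ev_nil : ev [::] = 1. Proof. exact: big_nil. Qed.
Lemma ev_cons x w : ev (x :: w) = evl x * ev w. Proof. exact: big_cons. Qed.
Lemma ev_cat u v : ev (u ++ v) = ev u * ev v. Proof. exact: big_cat. Qed.

Lemma evl_inv x : evl (inv_letter x) = (evl x)^-1.
Proof. by case: x => j []; rewrite /evl /= ?invgK. Qed.

Lemma ev_inv w : ev (inv_word w) = (ev w)^-1.
Proof.
elim: w => [|x w IH]; first by rewrite /inv_word /= ev_nil invg1.
by rewrite -cat1s inv_word_cat !ev_cat IH invMg; congr (_ * _); rewrite !ev_cons evl_inv ev_nil !mulg1.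
Qed.

Definition almost_model (E : nat) (mu : pres) : Prop :=
  (forall a, a \in mu.2 -> displ (ev a) <= E) /\ (forall j, mu.1 <= j -> displ (rho j) <= E).

Lemma displ_relators (R : seq word) (E : nat) (ws : seq (nat * bool)) :
  (forall a, a \in R -> displ (ev a) <= E) -> all (fun q => q.1 < size R) ws ->
  displ (ev (flatten [seq (if q.2 then relw R q.1 else inv_word (relw R q.1)) | q <- ws]))
    <= size ws * E.
Proof.
move=> RE; elim: ws => [|[i e] ws IH] /=; first by rewrite ev_nil displ1.
case/andP=> iR /IH {}IH; rewrite ev_cat mulSn (leq_trans (displM _ _)) // leq_add //.
by case: e; rewrite ?ev_inv ?displV; apply/RE/mem_nth.
Qed.

Lemma displ_set_nth (R : seq word) (E E' : nat) i a :
  (forall a, a \in R -> displ (ev a) <= E) -> E <= E' -> i < size R ->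
  displ (ev a) <= E' -> forall a', a' \in set_nth [::] R i a -> displ (ev a') <= E'.
Proof.
move=> RE EE' iR aE a' /(nthP [::])[k]; rewrite size_set_nth (maxn_idPr iR) => kR <-.
rewrite nth_set_nth /=; case: eqP => // _.
by apply: leq_trans EE'; apply/RE/mem_nth.
Qed.

Lemma almost_model_tstep d E mu nu :
  tstep d mu nu -> almost_model E mu -> almost_model (d.+2 * E) nu.
Proof.
have E1 : E <= d.+2 * E by rewrite leq_pmull.
have W j : displ (rho j) <= E -> displ (rho j) <= d.+2 * E by move/leq_trans; apply.
have Wr (R : seq word) i : (forall a, a \in R -> displ (ev a) <= E) -> i < size R ->
    displ (ev (relw R i)) <= d.+2 * E.
  by move=> RE iR; apply: leq_trans E1; apply/RE/mem_nth.
case=> {mu nu} [r R i u v x iR Ri _|r R i u v x iR Ri|r R i n iR|r R i iR|r R i j iR jR _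
  |r R ws wsR wsd|r R ws wsR wsd|r R n nR|r R n nR] [/= RE jE]; split=> //= ;
  try (by move=> j' /jE/W).
- apply: (displ_set_nth RE E1 iR); have := Wr _ _ RE iR.
  by rewrite Ri !ev_cat !ev_cons evl_inv mulKVg.
- apply: (displ_set_nth RE E1 iR); have := Wr _ _ RE iR.
  by rewrite Ri !ev_cat !ev_cons evl_inv mulKVg.
- apply: (displ_set_nth RE E1 iR); have := Wr _ _ RE iR.
  rewrite -{1}(cat_take_drop n (relw R i)) /rot !ev_cat.
  by rewrite -(displJ _ (ev (take n (relw R i)))) conjgE mulgA mulKg.
- by apply: (displ_set_nth RE E1 iR); rewrite ev_inv displV; apply: Wr.
- apply: (displ_set_nth RE E1 iR); rewrite ev_cat (leq_trans (displM _ _)) //.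
  rewrite !mulSn leq_add ?(leq_trans _ (leq_addr _ _)) //; exact/RE/mem_nth.
- move=> a; rewrite mem_rcons inE => /predU1P[->|/RE/leq_trans]; last exact.
  rewrite ev_cons mulSn (leq_trans (displM _ _)) // leq_add ?jE //.
  apply: leq_trans (displ_relators RE wsR) _; rewrite leq_mul2r; lia.
- by move=> j' /ltnW /jE/W.
- by move=> a aR; apply: leq_trans E1; apply: RE; rewrite mem_rcons inE aR orbT.
- move=> j; rewrite leq_eqVlt => /predU1P[<-|/jE/W//].
  have {}RE' a : a \in R -> displ (ev a) <= E.
    by move=> aR; apply: RE; rewrite mem_rcons inE aR orbT.
  have := displ_relators RE' wsR.
  set w := flatten _ => wE.
  have rw : rho r = ev ((r, true) :: w) * (ev w)^-1 by rewrite ev_cons mulgK.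
  rewrite rw (leq_trans (displM _ _)) // displV mulSn leq_add //; last first.
    by apply: leq_trans wE _; rewrite leq_mul2r; lia.
  by apply: RE; rewrite mem_rcons mem_head.
- move=> a; rewrite mem_cat inE orbCA => /predU1P[->|]; first by rewrite ev_nil displ1.
  by rewrite -mem_cat cat_take_drop => /RE /leq_trans; apply.
- move=> a aR; apply: leq_trans E1; apply: RE.
  by rewrite mem_cat inE orbCA -mem_cat cat_take_drop aR orbT.
Qed.

Lemma almost_model_tsteps d n E mu nu :
  tsteps d n mu nu -> almost_model E mu -> almost_model (d.+2 ^ n * E) nu.
Proof.
move=> st; elim: st E => {n mu nu} [mu|n mu nu rho' st _ IH] E; first by rewrite mul1n.
by move/(almost_model_tstep st)/IH; rewrite mulnA expnSr.
Qed.

End Displacement.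

Definition is_phase (X : finType) (s : {perm X}) (L : nat) (th : X -> nat) : Prop :=
  forall p, th p < L /\ th (s p) = (th p).+1 %% L.

Lemma sum_top N L : \sum_(c < L) (L <= c + N) <= N.
Proof.
suff: \sum_(c < L) (L <= c + N) <= minn L N by move/leq_trans; apply; exact: geq_minr.
elim: L => [|L IH]; first by rewrite big_ord0.
rewrite big_ord_recl add0n; under eq_bigr do rewrite lift0 addSn ltnS.
apply: leq_trans (leq_add (leqnn _) IH) _; case: (ltnP L N); lia.
Qed.

Section Phase.
Variables (X : finType) (s : {perm X}) (L : nat) (th : X -> nat).
Hypothesis ths : is_phase s L th.

Lemma phase_expg k p : th ((s ^+ k)%g p) = (th p + k) %% L.
Proof.
elim: k => [|k IH]; first by rewrite expg0 perm1 addn0 modn_small //; case: (ths p).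
by rewrite expgSr permM (ths _).2 IH -addn1 modnDml -addnA addn1.
Qed.

Lemma phase_expg_inj i j p : i < L -> j < L -> (s ^+ i)%g p = (s ^+ j)%g p -> i = j.
Proof.
move=> iL jL /(congr1 th); rewrite !phase_expg => /eqP.
by rewrite eqn_modDl !modn_small // => /eqP.
Qed.

Lemma phase_equidistributed (P : pred nat) :
  L * #|[set p | P (th p)]| = (\sum_(c < L) P c) * #|X|.
Proof.
have cE : #|[set p | P (th p)]| = \sum_p P (th p).
  by rewrite -sum1dep_card big_mkcond /=; apply: eq_bigr => p _; case: (P _).
transitivity (\sum_(k < L) \sum_p (P (th ((s ^+ k)%g p)) : nat)).
  rewrite -[L in LHS]card_ord -sum_nat_const cE; apply: eq_bigr => k _.
  by rewrite [LHS](reindex_inj (@perm_inj _ (s ^+ k)%g)).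
rewrite exchange_big /= mulnC -sum_nat_const; apply: eq_bigr => p _.
have L0 : 0 < L by case: (ths p) => /(leq_trans _)->.
pose h (k : 'I_L) := Ordinal (ltn_pmod (th p + k) L0).
have h_inj : injective h.
  move=> k k' /(congr1 val) /= /eqP.
  by rewrite eqn_modDl !modn_small // => /eqP /val_inj.
by rewrite [RHS](reindex_inj h_inj) /=; apply: eq_bigr => k _; rewrite phase_expg.
Qed.

Variable N : nat.
Hypothesis N0 : 0 < N.
Definition block (p : X) : bool := odd (th p %/ N).

Lemma block_change : N <= L -> N * #|[set p | block (s p) != block p]| <= 2 * #|X|.
Proof.
move=> NL; have L0 : 0 < L by exact: leq_trans NL.
pose P c := odd ((c.+1 %% L) %/ N) != odd (c %/ N).
have -> : [set p | block (s p) != block p] = [set p | P (th p)].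
  by apply/setP=> p; rewrite !inE /block (ths p).2.
rewrite -(leq_pmul2l L0) mulnCA phase_equidistributed mulnA.
have PE c : c < L -> P c <= (N %| c.+1) + (c.+1 == L).
  move=> cL; rewrite /P; have [//|cL'] := eqVneq c.+1 L; first by case: (_ != _); rewrite addn1.
  rewrite modn_small; last by rewrite ltn_neqAle cL'.
  have [//|ndvd] := boolP (N %| c.+1); first by case: (_ != _).
  suff -> : c.+1 %/ N = c %/ N by rewrite eqxx.
  have := divnS c N0; rewrite (negbTE ndvd) add0n; exact.
have SP : \sum_(c < L) P c <= L %/ N + 1.
  apply: (@leq_trans (\sum_(c < L) ((N %| c.+1) + (c.+1 == L)))).
    by apply: leq_sum => c _; apply: PE.
  rewrite big_split /= leq_add //.
    rewrite divn_count_dvd -(big_mkord xpredT (fun c => N %| c.+1 : nat)).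
    by rewrite (big_addn 0 L.+1 1) subn1 /=; under [X in _ <= X]eq_bigr do rewrite addn1.
  case: L L0 => // L' _; rewrite (bigD1 ord_max) //= eqxx big1 // => c.
  by rewrite -val_eqE /= eqSS => /negbTE->.
have NS : N * (\sum_(c < L) P c) <= L * 2 by have := leq_trunc_div L N; nia.
by rewrite mulnA leq_mul2r NS orbT.
Qed.

Lemma block_flip : N * N <= L ->
  N * #|[set p | block ((s ^+ N)%g p) == block p]| <= #|X|.
Proof.
move=> NNL; have L0 : 0 < L by apply: leq_trans NNL; rewrite muln_gt0 N0.
pose P c := odd (((c + N) %% L) %/ N) == odd (c %/ N).
have -> : [set p | block ((s ^+ N)%g p) == block p] = [set p | P (th p)].
  by apply/setP=> p; rewrite !inE /block phase_expg.
rewrite -(leq_pmul2l L0) mulnCA phase_equidistributed mulnA leq_mul2r; apply/orP; right.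
have NL : N <= L by apply: leq_trans NNL; rewrite leq_pmull.
apply: leq_trans NNL; rewrite leq_mul2l; apply/orP; right.
have PE c : c < L -> P c <= (L <= c + N).
  move=> cL; rewrite /P; case: (leqP L (c + N)) => h; first exact: leq_b1.
  rewrite modn_small //.
  by rewrite divnDr ?divnn ?N0 // oddD addbT eqb_negLR; case: odd.
apply: leq_trans (sum_top N L); apply: leq_sum => c _; exact: PE.
Qed.

End Phase.

(* The new bottom of the chain adds [2 ^ th p] to a coordinate mod [2 ^ L - 1], where [th] is
   the phase of the old bottom: one step of the latter doubles the increment. *)
Section Extend.
Variables (X : finType) (s : {perm X}) (L : nat) (th : X -> nat).
Hypotheses (Lgt0 : 0 < L) (ths : is_phase s L th).
Let L' := (2 ^ L).-1.

Lemma gt0_mersenne : 0 < L'.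
Proof. by rewrite /L'; have := ltn_expl L (isT : 1 < 2); lia. Qed.

Lemma expn_mod_mersenne : 2 ^ L = 1 %[mod L'].
Proof. by rewrite -[2 ^ L]prednK ?expn_gt0 // -addn1 modnDl. Qed.

Definition twist_fun (ap : 'I_L' * X) : 'I_L' * X :=
  (Ordinal (ltn_pmod (ap.1 + 2 ^ th ap.2) gt0_mersenne), ap.2).

Lemma twist_inj : injective twist_fun.
Proof.
case=> a p [b q] [/= + epq]; rewrite epq => /eqP.
by rewrite eqn_modDr !modn_small // => /eqP /val_inj->.
Qed.

Definition twist : {perm 'I_L' * X} := perm twist_inj.

Definition snd_fun (u : {perm X}) (ap : 'I_L' * X) : 'I_L' * X := (ap.1, u ap.2).

Lemma snd_fun_inj u : injective (snd_fun u).
Proof. by case=> a p [b q] [/= -> /perm_inj->]. Qed.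

Definition snd_perm u : {perm 'I_L' * X} := perm (@snd_fun_inj u).

Lemma snd_perm_twist : (snd_perm s * twist = twist ^+ 2 * snd_perm s)%g.
Proof.
apply/permP=> -[a p]; rewrite expgS expg1 !permM !permE /snd_fun /twist_fun /=.
congr pair; apply/val_inj => /=; rewrite modnDml -addnA addnn -mul2n -expnS.
apply/eqP; rewrite eqn_modDl (ths p).2.
have [eL|ne] := eqVneq (th p).+1 L.
  by rewrite eL modnn expn0; apply/eqP/esym/expn_mod_mersenne.
by rewrite [(th p).+1 %% L]modn_small // ltn_neqAle ne (ths p).1.
Qed.

Definition twist_phase (ap : 'I_L' * X) : nat := (ap.1 * 2 ^ (L - th ap.2)) %% L'.

Lemma twist_phaseP : is_phase twist L' twist_phase.
Proof.
case=> a p; split; first exact: ltn_pmod gt0_mersenne.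
rewrite permE /twist_phase /twist_fun /= modnMml mulnDl -expnD subnKC ?(ltnW (ths p).1) //.
by rewrite -[X in _ = X %% _]addn1 modnDml -modnDmr expn_mod_mersenne modnDmr.
Qed.

Lemma snd_perm_phase u M th' : is_phase u M th' -> is_phase (snd_perm u) M (fun ap => th' ap.2).
Proof. by move=> uth [a p]; rewrite permE /=; apply: uth. Qed.

Lemma snd_permM u v : (snd_perm u * snd_perm v)%g = snd_perm (u * v)%g.
Proof. by apply/permP=> -[a p]; rewrite permM !permE /snd_fun /= permM. Qed.

End Extend.

Lemma bs_chain (K L0 : nat) : exists (X : finType) (xi : nat -> {perm X})
    (L : nat -> nat) (th : nat -> X -> nat),
  [/\ 0 < #|X|, forall j, L0 <= L j, forall j, j <= K -> is_phase (xi j) (L j) (th j) &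
      forall j, j < K -> (xi j.+1 * xi j = xi j ^+ 2 * xi j.+1)%g].
Proof.
elim: K => [|K [X [xi [L [th [X0 LL xith rel]]]]]].
  pose s (i : 'I_L0.+1) : 'I_L0.+1 := Ordinal (ltn_pmod i.+1 (ltn0Sn L0)).
  have s_inj : injective s.
    move=> i j /(congr1 val) /= /eqP.
    by rewrite -addn1 -[j.+1]addn1 eqn_modDr !modn_small // => /eqP /val_inj.
  exists 'I_L0.+1, (fun _ => perm s_inj), (fun _ => L0.+1), (fun _ i => val i).
  by split=> //; [rewrite card_ord | move=> j _ p; rewrite permE ltn_ord].
have L00 : 0 < L 0 by case/card_gt0P: X0 => p _; have [/(leq_trans _)->] := xith 0 isT p.
exists ('I_(2 ^ L 0).-1 * X)%type,
  (fun j => if j is j'.+1 then snd_perm (L 0) (xi j') else twist (th 0) L00),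
  (fun j => if j is j'.+1 then L j' else (2 ^ L 0).-1),
  (fun j ap => if j is j'.+1 then th j' ap.2 else twist_phase (th 0) ap).
split.
- by rewrite card_prod muln_gt0 card_ord X0 andbT; apply: gt0_mersenne.
- by case=> [|j] //; have := LL 0; have := ltn_expl (L 0) (isT : 1 < 2); lia.
- by case=> [|j] jK; [apply: twist_phaseP; apply: xith | apply: snd_perm_phase; apply: xith].
- case=> [|j] jK; first by apply: snd_perm_twist; apply: xith.
  by rewrite /= expgS expg1 !snd_permM rel // expgS expg1.
Qed.

Section TwoByTwo.
Variable A : comUnitRingType.
Local Open Scope ring_scope.

Definition mx2 (a b c d : A) : 'M[A]_2 :=
  \matrix_(i < 2, j < 2) if i == 0 then (if j == 0 then a else b) else (if j == 0 then c else d).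

Lemma mul_mx2 a b c d a' b' c' d' : mx2 a b c d * mx2 a' b' c' d' =
  mx2 (a * a' + b * c') (a * b' + b * d') (c * a' + d * c') (c * b' + d * d').
Proof.
apply/matrixP=> i j; rewrite !mxE !big_ord_recl big_ord0 !mxE /= addr0.
by case: (i == 0); case: (j == 0).
Qed.

Lemma scalar_mx2 a : a%:M = mx2 a 0 0 a.
Proof.
apply/matrixP=> i j; rewrite !mxE.
by case: i => [[|[|]]] // ?; case: j => [[|[|]]].
Qed.

End TwoByTwo.

Lemma binary_icosahedral : exists (gT : finGroupType) (b f c : gT),
  [/\ b ^+ 3 = 1, f ^+ 5 = c, f ^+ 10 = 1 & b * f * b = f ^+ 4]%g /\
  c <> 1%g /\ forall x, (c * x = x * c)%g.
Proof.
pose B : 'M['F_5]_2 := mx2 0 (-1) 1 (-1).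
pose F : 'M['F_5]_2 := mx2 (-1) (-1) 0 (-1).
have one2 : 1%R = mx2 1 0 0 1 :> 'M['F_5]_2 by rewrite -scalar_mx2.
have B3 : (B ^+ 3 = 1)%R.
  by rewrite !exprS expr0 mulr1 /B /F !mul_mx2 one2; congr mx2; apply/val_inj.
have F4 : (F ^+ 4 = mx2 1 (-1) 0 1)%R.
  by rewrite !exprS expr0 mulr1 /B /F !mul_mx2; congr mx2; apply/val_inj.
have F5 : (F ^+ 5 = - 1)%R.
  rewrite exprS F4 /F mul_mx2 -[1%R in RHS]/(1%:M)%R -raddfN /= scalar_mx2.
  by congr mx2; apply/val_inj.
have F10 : (F ^+ 10 = 1)%R by rewrite (exprM F 5 2) F5 sqrrN expr1n.
have BFB : (B * F * B = F ^+ 4)%R.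
  by rewrite F4 /B /F !mul_mx2; congr mx2; apply/val_inj.
have BV : (B *m (B ^+ 2) = 1%:M)%R by exact: etrans (esym (exprS B 2)) B3.
have FV : (F *m (F ^+ 9) = 1%:M)%R by exact: etrans (esym (exprS F 9)) F10.
have uB : (B \is a GRing.unit)%R := (mulmx1_unit BV).1.
have uF : (F \is a GRing.unit)%R := (mulmx1_unit FV).1.
pose b : {unit 'M['F_5]_2} := FinRing.unit _ uB.
pose f : {unit 'M['F_5]_2} := FinRing.unit _ uF.
have valE : forall (x : {unit 'M['F_5]_2}) n, val (x ^+ n)%g = (val x ^+ n)%R.
  move=> x; elim=> [|n IH]; first by rewrite expg0 expr0.
  by rewrite expgS exprS /= -IH.
exists {unit 'M['F_5]_2}, b, f, (f ^+ 5)%g; split.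
  by split=> //; apply/val_inj; rewrite /= ?valE.
have vf5 : val (f ^+ 5)%g = (-1)%R by rewrite valE.
split=> [e|x]; last first.
  apply/val_inj; apply: (etrans (congr1 (fun m => m * val x)%R vf5)).
  by apply: (etrans _ (congr1 (fun m => val x * m)%R (esym vf5))); rewrite mulN1r mulrN1.
have := vf5; rewrite e => /matrixP/(_ 0 0)%R; rewrite !mxE => /(congr1 val).
by [].
Qed.

Lemma fiber_perms : exists (Y : finType) (B F : bool -> {perm Y}) (flip : {perm Y}) (sg : Y -> bool),
  [/\ 0 < #|Y|, forall i, (B i * F (~~ i) = F (~~ i) * B i)%g &
      forall i, [/\ B i ^+ 3 = 1, F i ^+ 5 = flip, F i ^+ 10 = 1 & B i * F i * B i = F i ^+ 4]%g] /\
  forall y, sg (flip y) = ~~ sg y.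
Proof.
have [gT [b [f [c [[b3 f5 f10 bfb] [c1 cC]]]]]] := binary_icosahedral.
pose rm (x : gT) : {perm gT} := perm (@mulIg _ x).
pose lm (x : gT) : {perm gT} := perm (@mulgI _ x^-1)%g.
have rmM x y : rm (x * y)%g = (rm x * rm y)%g.
  by apply/permP=> u; rewrite permM !permE mulgA.
have lmM x y : lm (x * y)%g = (lm x * lm y)%g.
  by apply/permP=> u; rewrite permM !permE invMg mulgA.
have rm1 : rm 1%g = 1%g by apply/permP=> u; rewrite !permE mulg1.
have lm1 : lm 1%g = 1%g by apply/permP=> u; rewrite !permE invg1 mul1g.
have rmX x k : (rm x ^+ k = rm (x ^+ k))%g by elim: k => // k IH; rewrite !expgS rmM IH.
have lmX x k : (lm x ^+ k = lm (x ^+ k))%g by elim: k => // k IH; rewrite !expgS lmM IH.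
have lr x y : (lm x * rm y = rm y * lm x)%g.
  by apply/permP=> u; rewrite !permM !permE mulgA.
have cc : (c * c = 1)%g by rewrite -f5 -expgD.
have lc : lm c = rm c.
  apply/permP=> u; rewrite !permE -cC; congr mulg.
  by apply/eqP; rewrite eq_invg_mul cc.
exists gT, (fun i => if i then rm b else lm b), (fun i => if i then rm f else lm f), (rm c),
  (fun y => enum_rank y < enum_rank (y * c)%g); split; last first.
  move=> y; rewrite permE -mulgA cc mulg1 -leqNgt ltn_neqAle andb_idl // => _.
  apply/eqP => /val_inj/enum_rank_inj e; case: c1.
  by apply: (mulgI y); rewrite mulg1 e.
split; first by apply/card_gt0P; exists 1%g.
  by case=> /=.
by case; split; rewrite ?rmX ?lmX -?rmM -?lmM ?b3 ?f5 ?f10 ?bfb.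
Qed.

Section Counting.
Variables T1 T2 T3 : finType.

Lemma card_pred_pair (Q : T1 -> T2 -> bool) :
  #|[set w : T1 * (T2 * T3) | Q w.1 w.2.1]| = (\sum_i #|[set j | Q i j]|) * #|T3|.
Proof.
rewrite -sum1dep_card -(pair_big_dep xpredT (fun i (j : T2 * T3) => Q i j.1) (fun _ _ => 1)) /=.
rewrite big_distrl /=; apply: eq_bigr => i _.
rewrite sum1dep_card -[in RHS]cardsT -cardsX; congr #|pred_of_set _|.
by apply/setP=> -[j k]; rewrite !inE andbT.
Qed.

Lemma card_pred_le N C (Q : T1 -> T2 -> bool) :
  (forall i, N * #|[set j | Q i j]| <= C * #|T2|) ->
  N * #|[set w : T1 * (T2 * T3) | Q w.1 w.2.1]| <= C * #|{: T1 * (T2 * T3)}|.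
Proof.
move=> QC; rewrite card_pred_pair !card_prod.
have H : N * (\sum_i #|[set j | Q i j]|) <= #|T1| * (C * #|T2|).
  by rewrite big_distrr -sum_nat_const; apply: leq_sum.
by rewrite mulnA (leq_trans (leq_mul H (leqnn _))) // -!mulnA mulnCA.
Qed.

Lemma card_pred_fst (Q : pred T1) :
  #|T1| * #|[set w : T1 * (T2 * T3) | Q w.1]| = #|[set i | Q i]| * #|{: T1 * (T2 * T3)}|.
Proof.
have -> : [set w : T1 * (T2 * T3) | Q w.1] = setX [set i | Q i] [set: T2 * T3].
  by apply/setP=> -[i j]; rewrite !inE andbT.
by rewrite cardsX cardsT !card_prod mulnCA.
Qed.

End Counting.

Lemma displ_div (T : finType) (s t : {perm T}) :
  displ (s * t^-1)%g = #|[set w | s w != t w]|.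
Proof.
rewrite /displ; congr #|pred_of_set _|; apply/setP=> w; rewrite !inE permM.
by rewrite -(inj_eq (@perm_inj _ t)) permKV.
Qed.

Section Plane.
Variable m : nat.
Local Notation A := 'I_m.+2.
Local Open Scope ring_scope.

(* The pair (a, b) stands for 3 a + b (1 - w), with w a primitive cube root of unity: [turn e] is
   a rotation by w, and both commutators below are the translation by 3. *)
Definition turn_fun (e : A) (u : A * A) : A * A :=
  (u.1 + u.2, - (3%:R * u.1 + 2%:R * u.2) - e).

Lemma turn_fun3 e u : turn_fun e (turn_fun e (turn_fun e u)) = u.
Proof. by case: u => a b; congr pair; rewrite /=; ring. Qed.

Lemma turn_fun_inj e : injective (turn_fun e).
Proof. exact: (can_inj (g := fun u => turn_fun e (turn_fun e u)) (turn_fun3 e)). Qed.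

Definition turn e : {perm A * A} := perm (@turn_fun_inj e).

Lemma turnV e u : (turn e)^-1%g u = turn_fun e (turn_fun e u).
Proof. by apply: (@perm_inj _ (turn e)); rewrite permKV permE turn_fun3. Qed.

Lemma turn2 e : (turn e ^+ 2 = (turn e)^-1)%g.
Proof. by apply/permP=> u; rewrite expgS expg1 permM turnV !permE. Qed.

Lemma turn_commutator u :
  ((turn 1%R)^-1 * turn 0%R * turn 1%R * (turn 0%R)^-1)%g u = (u.1 + 1, u.2).
Proof. by rewrite !permM !turnV !permE; case: u => a b; congr pair; rewrite /=; ring. Qed.

Lemma turnV_commutator u :
  (turn 1%R * (turn 0%R)^-1 * (turn 1%R)^-1 * turn 0%R)%g u = (u.1 + 1, u.2).
Proof. by rewrite !permM permE !turnV permE; case: u => a b; congr pair; rewrite /=; ring. Qed.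

End Plane.

Section Model.
Variables (m : nat) (X Y : finType) (xi : nat -> {perm X}) (L : nat -> nat) (th : nat -> X -> nat).
Variables (B F : bool -> {perm Y}) (flip : {perm Y}) (sg : Y -> bool).
Hypotheses (xith : forall j, j <= m.+1 -> is_phase (xi j) (L j) (th j))
  (bs : forall j, j < m.+1 -> (xi j.+1 * xi j = xi j ^+ 2 * xi j.+1)%g)
  (BF : forall i, (B i * F (~~ i) = F (~~ i) * B i)%g)
  (BFrel : forall i, [/\ B i ^+ 3 = 1, F i ^+ 5 = flip, F i ^+ 10 = 1 & B i * F i * B i = F i ^+ 4]%g)
  (sg_flip : forall y, sg (flip y) = ~~ sg y).

Local Notation A := 'I_m.+2.
Definition space : finType := (A * (X * (A * Y)))%type.
Implicit Types w : space.

(* A point is (level, (position on the cycles of x, (second plane coordinate, fibre))); the level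
   is also the first plane coordinate. *)
Definition shift_fun w : space := ((w.1 + 1)%R, w.2).
Lemma shift_inj : injective shift_fun.
Proof.
case=> a u [a' u'] /pair_equal_spec[/= e ->]; congr pair.
by apply: (@addIr _ 1%R).
Qed.
Definition shift : {perm space} := perm shift_inj.

Definition lvl_fun (s : A -> {perm X}) w : space := (w.1, (s w.1 w.2.1, w.2.2)).
Lemma lvl_inj s : injective (lvl_fun s).
Proof. by case=> a [p u] [b [q v]] [] /= -> /perm_inj-> ->. Qed.
Definition lvl s : {perm space} := perm (@lvl_inj s).

Definition fib_fun (u : A -> X -> {perm Y}) w : space :=
  (w.1, (w.2.1, (w.2.2.1, u w.1 w.2.1 w.2.2.2))).
Lemma fib_inj u : injective (fib_fun u).
Proof. by case=> a [p [c r]] [a' [p' [c' r']]] [] /= -> -> -> /perm_inj->. Qed.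
Definition fib u : {perm space} := perm (@fib_inj u).

Definition plane_fun (u : bool -> {perm A * A}) w : space :=
  let ab := u (sg w.2.2.2) (w.1, w.2.2.1) in (ab.1, (w.2.1, (ab.2, w.2.2.2))).
Lemma plane_inj u : injective (plane_fun u).
Proof.
case=> a [p [c r]] [a' [p' [c' r']]] [] /= + -> + er; rewrite er => e1 e2.
suff [-> ->] : (a, c) = (a', c') by [].
by apply: (@perm_inj _ (u (sg r'))); rewrite [LHS]surjective_pairing e1 e2 -surjective_pairing.
Qed.
Definition plane u : {perm space} := perm (@plane_inj u).

Local Open Scope group_scope.

Lemma lvlM s s' : lvl s * lvl s' = lvl (fun a => s a * s' a).
Proof. by apply/permP=> w; rewrite permM !permE /lvl_fun /= permM. Qed.

Lemma eq_lvl s s' : s =1 s' -> lvl s = lvl s'.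
Proof. by move=> e; apply/permP=> w; rewrite !permE /lvl_fun e. Qed.

Lemma lvlV s : (lvl s)^-1 = lvl (fun a => (s a)^-1).
Proof.
apply/eqP; rewrite eq_invg_mul lvlM; apply/eqP/permP=> w.
by rewrite permE /lvl_fun /= mulgV !perm1; case: w => a [].
Qed.

Lemma fibM u u' : fib u * fib u' = fib (fun a p => u a p * u' a p).
Proof. by apply/permP=> w; rewrite permM !permE /fib_fun /= permM. Qed.

Lemma fib1 : fib (fun _ _ => 1) = 1.
Proof. by apply/permP=> -[a [p [c r]]]; rewrite permE /fib_fun /= !perm1. Qed.

Lemma eq_fib u u' : (forall a p, u a p = u' a p) -> fib u = fib u'.
Proof. by move=> e; apply/permP=> w; rewrite !permE /fib_fun e. Qed.

Lemma fibX u k : fib u ^+ k = fib (fun a p => u a p ^+ k).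
Proof.
elim: k => [|k IH]; first by rewrite expg0 -fib1.
by rewrite expgS IH fibM; apply: eq_fib => a p; rewrite expgS.
Qed.

Lemma planeM u u' : plane u * plane u' = plane (fun i => u i * u' i).
Proof.
by apply/permP=> w; rewrite permM !permE /plane_fun /= permM -surjective_pairing.
Qed.

Lemma planeV u : (plane u)^-1 = plane (fun i => (u i)^-1).
Proof.
apply/eqP; rewrite eq_invg_mul planeM; apply/eqP/permP=> -[a [p [c r]]].
by rewrite permE /plane_fun /= mulgV !perm1.
Qed.

Lemma shift_lvl s : shift * lvl s = lvl (fun a => s (a + 1)%R) * shift.
Proof. by apply/permP=> w; rewrite !permM !permE. Qed.

Variables (n : nat) (s0 : seq bool).
Let N := tower n.

Definition blk (a : A) (p : X) : bool := block (th a) N p.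

Let x := lvl (fun a => xi a).
Let z := lvl (fun a => xi (a + 1)%R).
Let b := fib (fun a p => B (blk a p)).
Let f := fib (fun a p => F (blk a p)).
(* Inverting the rotation when [sg] flips gives f^5 g f^-5 = g^-1 = g^2, while the commutator
   word defining t yields the same translation for both values of [sg]. *)
Let turn_gen (e : A) := plane (fun i => if i then (turn e)^-1 else turn e).

Definition wordperm : seq bool -> {perm space} :=
  foldr (fun (e : bool) v => z * (x ^+ e * v)) 1.

Definition genperm (j : nat) : {perm space} :=
  nth 1 [:: x; z; shift; b; f; turn_gen 0%R; turn_gen 1%R; wordperm s0] j.

Local Notation ev := (ev genperm).

Fixpoint vperm k (a : A) : {perm X} :=
  if k is k'.+1 then vperm k' (a + 1)%R * xi a * (vperm k' (a + 1)%R)^-1 else xi a.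

Lemma ev_vword k : ev (vword k) = lvl (vperm k).
Proof.
elim: k => [|k IH]; first by rewrite ev_cons ev_nil mulg1.
rewrite /= !(ev_cons, ev_cat) ev_inv IH ev_nil !mulg1 !evl_inv.
rewrite -[evl _ Gt]/shift -[evl _ Gx]/x.
rewrite !mulgA shift_lvl lvlV -!mulgA.
rewrite [lvl _ * shift^-1](_ : _ = shift^-1 * lvl (fun a => (vperm k (a + 1)%R)^-1)); last first.
  by apply: (mulgI shift); rewrite mulKVg mulgA shift_lvl mulgK.
by rewrite mulKVg mulKVg !lvlM; apply: eq_lvl => a; rewrite mulgA.
Qed.

Lemma succ_val (a : A) : a < m.+1 -> ((a + 1)%R : A) = a.+1 :> nat.
Proof. by move=> am; rewrite /= modn_small addn1. Qed.

Lemma bs_expr j k : j < m.+1 -> xi j.+1 ^+ k * xi j = xi j ^+ (2 ^ k) * xi j.+1 ^+ k.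
Proof.
move=> jm; elim: k => [|k IH]; first by rewrite mul1g mulg1.
have sq i : xi j.+1 * xi j ^+ i = xi j ^+ (2 * i) * xi j.+1.
  elim: i => [|i IHi]; first by rewrite mul1g mulg1.
  by rewrite mulnS expgD [xi j ^+ i.+1]expgS mulgA bs // -!mulgA IHi.
by rewrite expgS -mulgA IH mulgA sq -mulgA -expgS expnS.
Qed.

Lemma vperm_tower k (a : A) : a + k < m.+2 -> vperm k a = xi a ^+ tower k.
Proof.
elim: k a => [|k IH] a /= ak; first by rewrite expg1.
have am : a < m.+1 by lia.
rewrite IH succ_val // ?addSnnS // bs_expr // mulgK //.
Qed.

Fixpoint weight (s : seq bool) : nat := if s is e :: s' then 2 * (e + weight s') else 0.

Lemma weight_le s : (weight s + 2 <= 2 ^ (size s).+1)%N.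
Proof.
elim: s => // e s IH; rewrite [weight _]/= -/(weight s) [size _]/= expnS.
by case: e; lia.
Qed.

Lemma weight_lt s : (weight s < 2 ^ (size s).+1)%N.
Proof. by apply: leq_trans (weight_le s); rewrite addn2. Qed.

Lemma odd_weight s : ~~ odd (weight s).
Proof. by case: s => //= e s; rewrite oddM. Qed.

Lemma weight_inj s s' : size s = size s' -> weight s = weight s' -> s = s'.
Proof.
elim: s s' => [|e s IH] [|e' s'] // [sz] /= /eqP; rewrite eqn_pmul2l // => /eqP ww.
have ee : e = e'.
  by have := congr1 odd ww; rewrite !oddD !(negbTE (odd_weight _)) !addbF !oddb.
by move: ww; rewrite ee => /addnI/(IH _ sz)->.
Qed.

Definition wordlvl (s : seq bool) (a : A) : {perm X} :=
  foldr (fun (e : bool) v => xi (a + 1)%R * (xi a ^+ e * v)) 1 s.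

Lemma wordperm_lvl s : wordperm s = lvl (wordlvl s).
Proof.
elim: s => [|e s IH] /=.
  by apply/permP=> -[a [p u]]; rewrite perm1 [RHS]permE /lvl_fun /= perm1.
by rewrite IH; case: e; rewrite ?expg1 ?expg0 ?mul1g !lvlM //; apply: eq_lvl => a /=; rewrite mul1g.
Qed.

Lemma ev_bitword s : ev (bitword s) = wordperm s.
Proof.
elim: s => [|e s IH] /=; first exact: ev_nil.
by rewrite ev_cons; case: e; rewrite ?ev_cons IH ?expg0 ?mul1g ?expg1.
Qed.

Lemma wordlvl_weight s (a : A) : a < m.+1 ->
  wordlvl s a = xi a ^+ weight s * xi a.+1 ^+ size s.
Proof.
move=> am; have sq i : xi a.+1 * xi a ^+ i = xi a ^+ (2 * i) * xi a.+1.
  elim: i => [|i IHi]; first by rewrite mul1g mulg1.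
  by rewrite mulnS expgD [xi a ^+ i.+1]expgS mulgA bs // -!mulgA IHi.
elim: s => [|e s IH]; first by rewrite mulg1.
rewrite -[wordlvl _ _]/(xi (a + 1)%R * (xi a ^+ e * wordlvl s a)).
by rewrite IH succ_val // [xi a ^+ e * _]mulgA -expgD mulgA sq -mulgA -expgS.
Qed.

Lemma ev_div u v :
  displ (ev (u ++ inv_word v)) = #|[set w | ev u w != ev v w]|.
Proof. by rewrite ev_cat ev_inv displ_div. Qed.

Lemma ev_div_eq u v : ev u = ev v -> displ (ev (u ++ inv_word v)) = 0%N.
Proof. by move=> e; rewrite ev_cat ev_inv e mulgV displ1. Qed.

Lemma ev_nseq k x0 : ev (nseq k x0) = evl genperm x0 ^+ k.
Proof. by elim: k => [|k IH]; rewrite ?ev_nil // /= ev_cons IH expgS. Qed.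

Lemma f5_fun w : (f ^+ 5) w = (w.1, (w.2.1, (w.2.2.1, flip w.2.2.2))).
Proof.
have -> : f ^+ 5 = fib (fun _ _ => flip).
  by rewrite fibX; apply: eq_fib => a p; case: (BFrel (blk a p)).
by rewrite permE.
Qed.

Lemma turn_gen_f e : f ^+ 5 * turn_gen e = turn_gen e ^+ 2 * f ^+ 5.
Proof.
have -> : turn_gen e ^+ 2 = plane (fun i => if i then turn e else (turn e)^-1).
  rewrite expgS expg1 planeM; apply/permP=> w; rewrite !permE /plane_fun.
  suff -> : (if sg w.2.2.2 then (turn e)^-1 else turn e) * (if sg w.2.2.2 then (turn e)^-1 else turn e)
    = if sg w.2.2.2 then turn e else (turn e)^-1 by [].
  by case: (sg _); have := turn2 e; rewrite expgS expg1 // => ee; rewrite -invMg ee invgK.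
apply/permP=> w; rewrite [LHS]permM [RHS]permM !f5_fun !permE /plane_fun /= sg_flip.
by case: (sg _).
Qed.

Hypotheses (NL : forall j, N * N <= L j) (mN : N * n.+1 <= m.+2)
  (sL : forall j, 2 ^ (size s0).+1 <= L j).

Lemma tower_gt0 k : (0 < tower k)%N.
Proof. by case: k => [|k] //; rewrite /tower iterS expn_gt0. Qed.

Lemma displ_bs : (N * displ (ev ([:: Gz; Gx] ++ inv_word [:: Gx; Gx; Gz])) <= 2 * #|space|)%N.
Proof.
rewrite ev_div.
have sub : [set w | ev [:: Gz; Gx] w != ev [:: Gx; Gx; Gz] w] \subset
    [set w : space | (m.+1 <= w.1)%N].
  apply/subsetP=> w; rewrite !inE; apply: contraR; rewrite -ltnNge => am.
  rewrite !ev_cons ev_nil !mulg1 -[evl _ Gz]/z -[evl _ Gx]/x !lvlM !permE /lvl_fun.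
  by rewrite succ_val // bs // expgS expg1 mulgA.
apply: (@leq_trans (N * #|[set w : space | (m.+1 <= w.1)%N]|)).
  by rewrite leq_mul2l (subset_leq_card sub) orbT.
have := card_pred_fst X (A * Y)%type (fun a : A => (m.+1 <= a)%N); rewrite card_ord.
have -> : [set i : A | (m.+1 <= i)%N] = [set ord_max].
  by apply/setP=> i; rewrite !inE -val_eqE /=; have := ltn_ord i; lia.
rewrite cards1 mul1n => E; rewrite -[#|space|]E mulnA leq_mul2r; apply/orP; right.
by apply: leq_trans (leq_pmull _ _) => //; apply: leq_trans mN; rewrite leq_pmulr.
Qed.

Lemma displ_bx : (N * displ (ev ([:: Gb; Gx] ++ inv_word [:: Gx; Gb])) <= 2 * #|space|)%N.
Proof.
rewrite ev_div.
pose Q (a : A) p := blk a (xi a p) != blk a p.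
apply: (@leq_trans (N * #|[set w : space | Q w.1 w.2.1]|)); last first.
  apply: card_pred_le => a; apply: (block_change (L := L a) (xith _) (tower_gt0 n)).
    by rewrite -ltnS.
  by apply: leq_trans (NL a); rewrite leq_pmull // tower_gt0.
rewrite leq_mul2l; apply/orP; right; apply/subset_leq_card/subsetP=> w.
rewrite !inE; apply: contraR => /negPn/eqP q.
rewrite !ev_cons ev_nil !mulg1 -[evl _ Gb]/b -[evl _ Gx]/x !permM !permE /lvl_fun /fib_fun /=.
by rewrite q.
Qed.

Lemma displ_vbf : (N * displ (ev ((vword n ++ Gb :: inv_word (vword n) ++ [:: Gf])
        ++ inv_word (Gf :: vword n ++ Gb :: inv_word (vword n)))) <= 2 * #|space|)%N.
Proof.
rewrite ev_div.
pose Q (a : A) p := blk a ((xi a ^+ N) p) == blk a p.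
have sub : [set w | ev (vword n ++ Gb :: inv_word (vword n) ++ [:: Gf]) w !=
     ev (Gf :: vword n ++ Gb :: inv_word (vword n)) w] \subset
    [set w : space | (m.+2 <= w.1 + n)%N] :|: [set w : space | Q w.1 w.2.1].
  apply/subsetP=> w; rewrite !inE; apply: contraR; rewrite negb_or -ltnNge => /andP[am q].
  rewrite !(ev_cons, ev_cat) ev_inv ev_vword ev_nil !mulg1 -[evl _ Gb]/b -[evl _ Gf]/f.
  rewrite lvlV !permM !permE /lvl_fun /fib_fun /= vperm_tower //.
  rewrite permK -!permM; apply/eqP; congr (_, (_, (_, _))).
  have -> : blk w.1 w.2.1 = ~~ blk w.1 ((xi w.1 ^+ N) w.2.1).
    by move: q; rewrite /Q; case: blk; case: blk.
  by rewrite BF.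
apply: leq_trans (leq_mul (leqnn N) (leq_trans (subset_leq_card sub) (leq_card_setU _ _))) _.
rewrite mulnDr mul2n -addnn leq_add //; last first.
  rewrite -[X in (_ <= X)%N]mul1n; apply: card_pred_le => a; rewrite mul1n.
  by apply: (block_flip (L := L a) (xith _) (tower_gt0 n)); rewrite // -ltnS.
have := card_pred_fst X (A * Y)%type (fun a : A => (m.+2 <= a + n)%N); rewrite card_ord.
have card_n : (#|[set i : A | (m.+2 <= i + n)%N]| <= n)%N.
  rewrite -sum1dep_card big_mkcond /=; apply: leq_trans (sum_top n m.+2).
  by apply: leq_sum => i _; case: leqP.
move=> E; have {}E : (m.+2 * #|[set w : space | (m.+2 <= w.1 + n)%N]| <= n * #|space|)%N.
  by rewrite E leq_mul2r card_n orbT.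
rewrite -(@leq_pmul2l m.+2) //; nia.
Qed.

Lemma almost_model_hard_pres : almost_model genperm ((2 * #|space|) %/ N)%N (hard_pres n s0).
Proof.
set E := ((2 * _) %/ N)%N.
split=> [a|j j8]; last by rewrite /genperm nth_default // displ1.
have lE d : (N * d <= 2 * #|space|)%N -> (d <= E)%N by rewrite leq_divRL ?tower_gt0 // mulnC.
rewrite mem_rcons inE => /predU1P[->|].
  by rewrite ev_div_eq // ev_bitword ev_cons ev_nil mulg1.
have relE u : ev u = 1 -> (displ (ev u) <= E)%N by move->; rewrite displ1.
have eqE u v : ev u = ev v -> (displ (ev (u ++ inv_word v)) <= E)%N by move/ev_div_eq->.
rewrite /hard_rels !inE.
move=> /predU1P[->|/predU1P[->|/predU1P[->|/predU1P[->|/predU1P[->|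
  /predU1P[->|/predU1P[->|/predU1P[->|/predU1P[->|/eqP->]]]]]]]]].
- by apply: eqE; rewrite !ev_cons ev_nil !mulg1; apply: shift_lvl.
- apply: eqE; rewrite !ev_cons ev_nil !mulg1 !evl_inv -[evl _ Gt]/shift.
  rewrite -[evl _ Gh]/(turn_gen 1%R) -[evl _ Gg]/(turn_gen 0%R) !planeV !planeM.
  apply/permP=> w; rewrite !permE /plane_fun /shift_fun.
  case: (sg _); rewrite ?invgK !mulgA ?turn_commutator ?turnV_commutator /=;
    by case: w => [? [? []]].
- exact: (lE _ displ_bs).
- exact: (lE _ displ_bx).
- exact: (lE _ displ_vbf).
- apply: relE; rewrite ev_nseq fibX -[RHS]fib1; apply: eq_fib => c p.
  by case: (BFrel (blk c p)).
- apply: relE; rewrite ev_nseq fibX -[RHS]fib1; apply: eq_fib => c p.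
  by case: (BFrel (blk c p)).
- apply: eqE; rewrite ev_nseq !ev_cons ev_nil mulg1 !fibM fibX; apply: eq_fib => c p.
  by case: (BFrel (blk c p)) => _ _ _ <-; rewrite mulgA.
- by apply: eqE; rewrite !ev_cat ev_nseq !ev_cons ev_nil !mulg1 turn_gen_f expgS expg1.
- by apply: eqE; rewrite !ev_cat ev_nseq !ev_cons ev_nil !mulg1 turn_gen_f expgS expg1.
Qed.

Lemma displ_bitword s : size s = size s0 -> s != s0 ->
  (#|space| <= 2 * displ (ev ([:: Gy] ++ inv_word (bitword s))))%N.
Proof.
move=> sz ss; rewrite ev_div.
have sub : [set w : space | (w.1 < m.+1)%N] \subset [set w | ev [:: Gy] w != ev (bitword s) w].
  apply/subsetP=> -[a [p u]]; rewrite !inE /= => am; apply: contra ss.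
  rewrite ev_cons ev_nil mulg1 -[evl _ Gy]/(wordperm s0) ev_bitword !wordperm_lvl !permE /lvl_fun /=.
  rewrite !wordlvl_weight // sz !permM => /eqP[] /perm_inj e; apply/eqP/weight_inj => //.
  apply/esym/(phase_expg_inj (xith (ltnW _)) _ _ e); first exact: am.
    exact: leq_trans (weight_lt _) (sL a).
  by apply: leq_trans (weight_lt _) _; rewrite sz.
apply: leq_trans (leq_mul (leqnn 2) (subset_leq_card sub)).
have := card_pred_fst X (A * Y)%type (fun a : A => (a < m.+1)%N); rewrite card_ord.
have -> : #|[set i : A | (i < m.+1)%N]| = m.+1.
  have -> : [set i : A | (i < m.+1)%N] = [set~ ord_max].
    by apply/setP=> i; rewrite !inE -val_eqE /=; have := ltn_ord i; lia.
  by rewrite cardsC1 card_ord.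
move=> E; rewrite -(@leq_pmul2l m.+2) // mulnCA E mulnA leq_mul2r; apply/orP; right; lia.
Qed.

End Model.

Lemma approximate_model n s0 : exists (T : finType) (rho : nat -> {perm T}),
  [/\ 0 < #|T|, almost_model rho ((2 * #|T|) %/ tower n) (hard_pres n s0) &
      forall s, size s = size s0 -> s != s0 ->
        #|T| <= 2 * displ (ev rho ([:: Gy] ++ inv_word (bitword s)))].
Proof.
pose N := tower n; pose m := N * n.+1.
have [Y [B [F [flip [sg [[Y0 BF BFrel] sgf]]]]]] := fiber_perms.
have [X [xi [L [th [X0 LL xith bs]]]]] := bs_chain m.+1 (N * N + 2 ^ (size s0).+1).
have mN : N * n.+1 <= m.+2 by rewrite -addn2 leq_addr.
have NL j : N * N <= L j by apply: leq_trans (LL j); apply: leq_addr.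
have sL j : 2 ^ (size s0).+1 <= L j by apply: leq_trans (LL j); apply: leq_addl.
exists (space m X Y), (genperm m xi th B F sg n s0); split.
- by rewrite !card_prod !muln_gt0 X0 Y0 !card_ord.
- exact: (almost_model_hard_pres xith bs BF BFrel sgf s0 NL mN).
- by move=> s; apply: (displ_bitword (L := L) B F sg xith bs).
Qed.

Lemma hard_pres_far n d k s s' : size s = size s' -> s != s' ->
  tsteps d k (hard_pres n s) (hard_pres n s') -> tower n <= 4 * d.+2 ^ k.
Proof.
move=> sz ss st; have [T [rho [T0 am far]]] := approximate_model n s.
have [+ _] := almost_model_tsteps st am.
set E := _ %/ _ => /(_ ([:: Gy] ++ inv_word (bitword s'))).
rewrite mem_rcons mem_head => /(_ isT) dE.
have TE : #|T| <= 2 * (d.+2 ^ k * E).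
  by apply: leq_trans (far s' (esym sz) _) _; rewrite ?leq_mul2l // eq_sym.
have NE : E * tower n <= 2 * #|T| by apply: leq_trunc_div.
rewrite -(leq_pmul2r T0); nia.
Qed.

Lemma size_inv_word w : size (inv_word w) = size w.
Proof. by rewrite size_rev size_map. Qed.

Lemma size_vword k : size (vword k) + 5 = 6 * 2 ^ k.
Proof. by elim: k => //= k IH; rewrite !size_cat /= size_cat size_inv_word /= expnS; lia. Qed.

Lemma size_bitword s : size (bitword s) <= 2 * size s.
Proof. by elim: s => //= -[] s IH /=; lia. Qed.

Lemma hard_pres_length n s : pres_length (hard_pres n s) <= 24 * 2 ^ n + 2 * size s + 57.
Proof.
rewrite /pres_length /= !size_cat /= !size_cat /= !size_inv_word /=.
rewrite !size_cat /= !size_inv_word /=.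
have := size_vword n; have := size_bitword s; lia.
Qed.

Definition letters_lt (r : nat) (w : word) : bool := all (fun x : letter => x.1 < r) w.

Lemma letters_lt_inv r w : letters_lt r (inv_word w) = letters_lt r w.
Proof. by rewrite /letters_lt all_rev all_map. Qed.

Lemma hard_pres_wf n s : pres_wf (hard_pres n s).
Proof.
have v8 : letters_lt 8 (vword n).
  elim: n => //= n IH; rewrite /letters_lt /= all_cat /= all_cat /= -!/(letters_lt 8 _).
  by rewrite letters_lt_inv IH.
have w8 : letters_lt 8 (bitword s) by elim: s => //= -[].
rewrite /pres_wf /= -!/(letters_lt 8 _).
by rewrite /letters_lt !all_cat /= -!/(letters_lt 8 _) !letters_lt_inv /=
  /letters_lt !all_cat /= -!/(letters_lt 8 _) !letters_lt_inv ?v8 ?w8.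
Qed.

Lemma expm_tower m k : expm m (tower k) = tower (m + k).
Proof. by rewrite /expm /tower iterD. Qed.

Lemma leq_expm m x y : x <= y -> expm m x <= expm m y.
Proof. by move=> xy; elim: m => //= m IH; rewrite leq_exp2l. Qed.

Lemma expm_ge m x : x <= expm m x.
Proof. by elim: m => //= m /leq_trans; apply; apply/ltnW/ltn_expl. Qed.

Lemma tower_ge_expn4 k : 4 <= k -> 4 ^ k <= tower k.
Proof.
elim: k => // k IH; rewrite leq_eqVlt => /predU1P[<-|k4].
  by rewrite (_ : 4 ^ 4 = 2 ^ 8) // /tower iterS leq_exp2l.
rewrite /tower iterS -/(tower k) expnS (_ : 4 * 4 ^ k = 2 ^ (2 * k.+1)); last first.
  by rewrite expnM -[2 ^ 2]/4 expnS.
rewrite leq_exp2l //; apply: leq_trans (IH k4).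
have := ltn_expl k (isT : 1 < 2); rewrite -[4]/(2 * 2) expnMn; nia.
Qed.

Lemma tower_bound m : exists c, forall l, c < l ->
  exists n, 4 * l.+2 ^ expm m l < tower n /\ 48 * 2 ^ n + 120 <= l.
Proof.
pose C := 96 * 2 ^ (m + 2) + 120; exists (tower (C + 4)) => l cl.
have l10 : 10 <= l.
  apply: leq_trans (ltnW cl); apply: leq_trans (tower_ge_expn4 (leq_addl C 4)).
  by apply: (@leq_trans (4 ^ 4)) => //; apply: leq_pexp2l => //; apply: leq_addl.
have ex : exists j, l <= tower j.
  exists l; apply: leq_trans (tower_ge_expn4 _); last by lia.
  exact/ltnW/ltn_expl.
have [j lj jmin] := ex_minnP ex.
case: j lj jmin => [|j] lj jmin; first by move: lj; rewrite /tower /=; lia.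
have jl : tower j < l by rewrite ltnNge; apply/negP => /jmin; rewrite ltnn.
have tower_mono a b : a <= b -> tower a <= tower b.
  move=> ab; rewrite -(subnK ab) -expm_tower; exact: expm_ge.
have jC : C + 4 <= j.
  rewrite leqNgt; apply/negP => jC; have := leq_trans lj (tower_mono _ _ jC); lia.
exists (m + 2 + j.+1); split; last first.
  have : 48 * 2 ^ (m + 2 + j.+1) + 120 <= 4 ^ j.
    have j2 := ltn_expl j (isT : 1 < 2).
    rewrite expnD [2 ^ j.+1]expnS (_ : 4 ^ j = 2 ^ j * 2 ^ j); last by rewrite -expnMn.
    have : C <= 2 ^ j by lia.
    rewrite /C; move: (2 ^ j) (2 ^ (m + 2)) j2 => u v _; nia.
  by move/leq_trans; apply; apply: leq_trans (ltnW jl); apply: tower_ge_expn4; lia.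
set e := expm m l; have le : l <= e by apply: expm_ge.
have e2 : 2 ^ 2 ^ e <= tower (m + 2 + j.+1).
  rewrite [m + 2]addnC -addnA -2!expm_tower [expm 2 _]/(2 ^ 2 ^ _) !leq_exp2l //.
  exact: leq_expm.
apply: leq_trans e2.
have l2 : l.+2 <= 2 ^ l.
  have -> : 2 ^ l = 2 * 2 ^ l.-1 by rewrite -expnS prednK //; lia.
  have := ltn_expl l.-1 (isT : 1 < 2); lia.
apply: (@leq_ltn_trans (2 ^ (2 + l * e))).
  by rewrite expnD expnM -[2 ^ 2]/4 leq_mul2l /= leq_exp2r //; lia.
rewrite ltn_exp2l //.
have sq_exp k : 10 <= k -> 2 + k * k < 2 ^ k.
  elim: k => // k IH; rewrite leq_eqVlt => /predU1P[<-|k10] //.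
  have := IH k10; rewrite expnS; nia.
apply: leq_ltn_trans (sq_exp e _); last by lia.
by rewrite leq_add2l leq_mul2r le orbT.
Qed.

Lemma bitseqs q : exists S : seq (seq bool),
  [/\ uniq S, size S = 2 ^ q & forall s, s \in S -> size s = q].
Proof.
exists [seq val t | t <- enum {: q.-tuple bool}]; split.
- by rewrite (map_inj_uniq val_inj) enum_uniq.
- by rewrite size_map -cardE card_tuple card_bool.
- by move=> _ /mapP[t _ ->]; rewrite size_tuple.
Qed.

(* M(l,m,8)_d > 1.18^l, i.e. there is an (l,m,8)_d-disconnected set S with
   |S| > (118/100)^l, written as 118^l < |S| * 100^l. *)
Theorem theorem5p5 :
  forall m : nat, 0 < m ->
  exists c : nat, forall l d : nat, c < l -> d <= l ->
    exists S : seq pres, disconnected l m 8 d S /\ 118 ^ l < size S * 100 ^ l.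
Proof.
move=> m _; have [c cP] := tower_bound m; exists c => l d cl dl.
have [n [nl nlen]] := cP l cl; pose q := (l + 3) %/ 4.
have [S [uS sS qS]] := bitseqs q.
have far s s' k : s \in S -> s' \in S -> s != s' -> k <= expm m l ->
    ~ tsteps d k (hard_pres n s) (hard_pres n s').
  move=> /qS sq /qS sq' ss kl /hard_pres_far; rewrite sq sq' => /(_ erefl ss).
  apply/negP; rewrite -ltnNge; apply: leq_ltn_trans nl; rewrite leq_mul2l /=.
  by apply: (@leq_trans (l.+2 ^ k)); [case: (k) => // k'; rewrite leq_exp2r | rewrite leq_exp2l].
exists [seq hard_pres n s | s <- S]; split; [split; [|split]|].
- rewrite map_inj_in_uniq // => s s' sS' sS'' e; apply/eqP/negPn/negP => ss.
  by apply: (far s s' 0) => //; rewrite e; apply: tsteps0.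
- move=> _ /mapP[s /qS sq ->]; split=> //; first exact: hard_pres_wf; last exact: hard_pres_trivial.
  by apply: leq_trans (hard_pres_length n s) _; rewrite sq /q; lia.
- move=> _ _ /mapP[s sI ->] /mapP[s' sI' ->] ne k kl.
  by apply: far => //; apply: contraNneq ne => ->.
rewrite size_map sS -(@ltn_exp2r _ _ 4) // expnMn -!expnM ![_ * 4]mulnC.
rewrite [118 ^ _]expnM [100 ^ _]expnM.
apply: (@leq_trans (2 ^ l * (100 ^ 4) ^ l)); last first.
  by rewrite leq_mul2r leq_exp2l // /q orbC; lia.
have base : 118 ^ 4 < 2 * 100 ^ 4 by rewrite !expnS !expn0; lia.
by rewrite -expnMn ltn_exp2r; [exact: base | lia].
Qed.
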